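(* Let $M$ be a left $R$-module that is projective in $\sigma[M]$ and semiprime. Suppose that $M$ satisfies ACC on annihilators and that every submodule $0\neq N\subseteq M$ contains a uniform submodule. If $P_1,P_2,\dots,P_n$ are the minimal primes in $M$, then $$\widehat{N_1}\oplus\widehat{N_2}\oplus\cdots\oplus\widehat{N_n}=\widehat{M},$$ where $N_i=\mathrm{Ann}_M^r(P_i)$ for $1\le i\le n$.
   Context: $R$ is an associative ring with unity; modules are unitary left $R$-modules. For a left $R$-module $M$, a module $X$ is $M$-generated if it is an epimorphic image of a direct sum of copies of $M$, and $\sigma[M]$ is the full subcategory of left $R$-modules isomorphic to a submodule of an $M$-generated module. $M$ is projective in $\sigma[M]$ if $\mathrm{Hom}_R(M,-)$ is exact on short exact sequences in $\sigma[M]$. A submodule $N\subseteq M$ is fully invariant if $f(N)\subseteq N$ for all $f\in \mathrm{End}_R(M)$. For submodules $K,L$ of $M$, $K_ML=\sum\{f(K)\mid f\in \mathrm{Hom}_R(M,L)\}$. A fully invariant submodule $N\neq M$ is prime in $M$ if for all fully invariant submodules $K,L$ of $M$, $K_ML\subseteq N$ implies $K\subseteq N$ or $L\subseteq N$; it is semiprime in $M$ if for every fully invariant submodule $K$ of $M$, $K_MK\subseteq N$ implies $K\subseteq N$. $M$ is a semiprime module if $0$ is semiprime in $M$ (in particular $M\ne 0$). A minimal prime in $M$ is a submodule prime in $M$ that is minimal under inclusion among the submodules prime in $M$; ''the minimal primes $P_1,\dots,P_n$'' means the complete list without repetition. For a submodule $N$ of $M$, the right annihilator is $\mathrm{Ann}_M^r(N)=\sum\{L\subseteq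 M\mid N_ML=0\}$, the sum over submodules $L$ of $M$. $M$ satisfies ACC on annihilators if the set $\{\bigcap_{f\in X}\ker f\mid X\subseteq \mathrm{End}_R(M)\}$ satisfies the ascending chain condition. A module is uniform if it is nonzero and any two of its nonzero submodules have nonzero intersection. Injective hulls exist in $\sigma[M]$; $\widehat{X}$ denotes the injective hull of $X$ in $\sigma[M]$, and for a submodule $N\subseteq M$ the hull $\widehat N$ is taken inside $\widehat M$. *)

(* Defs.v *)
From HB Require Import structures.
From mathcomp Require Import all_boot all_algebra.
From mathcomp Require Import boolp classical_sets functions cardinality.

Set Implicit Arguments.
Unset Strict Implicit.
Unset Printing Implicit Defensive.

Import GRing.Theory.
Local Open Scope classical_set_scope.
Local Open Scope ring_scope.

(* A submodule coerces both to its underlying set and to a type, the latter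
   carrying the induced [lmodType] structure with inclusion [\val]. *)
Record submod (R : pzRingType) (V : lmodType R) := Submod {
  submod_set : set V;
  submod_setP : submod_closed (mem submod_set) }.

Definition submod_pred (R : pzRingType) (V : lmodType R) (N : submod V) :
  {pred V} := mem (submod_set N).
HB.instance Definition _ (R : pzRingType) (V : lmodType R) (N : submod V) :=
  GRing.isSubmodClosed.Build R V (submod_pred N) (submod_setP N).

Record submod_type (R : pzRingType) (V : lmodType R) (N : submod V) :=
  SubmodElt { submod_val :> V; submod_valP : submod_val \in submod_pred N }.
Arguments submod_type {R V} N.

HB.instance Definition _ (R : pzRingType) (V : lmodType R) (N : submod V) :=
  [isSub for @submod_val R V N].
HB.instance Definition _ (R : pzRingType) (V : lmodType R) (N : submod V) :=
  [Choice of submod_type N by <:].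
HB.instance Definition _ (R : pzRingType) (V : lmodType R) (N : submod V) :=
  [SubChoice_isSubLmodule of submod_type N by <:].

Definition submod_lmod (R : pzRingType) (V : lmodType R) (N : submod V) :
  lmodType R := submod_type N.
Coercion submod_lmod : submod >-> GRing.Lmodule.type.
Coercion submod_set : submod >-> set.

Section Submodules.
Variables (R : pzRingType) (V : lmodType R).
Implicit Types (N K L : submod V) (F : set (submod V)).

Lemma submod0_subproof : submod_closed (mem [set (0 : V)]).
Proof.
split=> [|a u v]; first by rewrite inE.
by rewrite !inE => /= -> ->; rewrite scaler0 addr0.
Qed.
Definition submod0 : submod V := Submod submod0_subproof.

Definition sum_set F : set V :=
  [set x | exists2 s : seq V,
    (forall y, y \in s -> exists2 N, F N & (N : set V) y) & x = \sum_(y <- s) y].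

Lemma submod_sum_subproof F : submod_closed (mem (sum_set F)).
Proof.
split=> [|a u v]; first by rewrite inE; exists [::] => //; rewrite big_nil.
rewrite !inE => -[s sF ->] [t tF ->].
exists ([seq a *: y | y <- s] ++ t).
  move=> y; rewrite mem_cat => /orP[/mapP[z /sF[N FN Nz] ->]|/tF //].
  exists N => //; apply/set_mem; apply: (@rpredZ _ _ (submod_pred N) a).
  exact/mem_set.
by rewrite big_cat big_map scaler_sumr.
Qed.
Definition submod_sum F : submod V := Submod (submod_sum_subproof F).

Definition internal_direct_sum n (H : 'I_n -> submod V) : Prop :=
  (submod_sum [set H i | i in [set: 'I_n]] : set V) = [set: V] /\
  forall i, (H i : set V) `&` submod_sum [set H j | j in [set j | j != i]]
            = [set 0].

Definition essential (N : set V) : Prop :=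
  forall K, (K : set V) <> [set 0] -> (K : set V) `&` N <> [set 0].

Definition uniform : Prop :=
  [set: V] <> [set 0] /\
  forall K L, (K : set V) <> [set 0] -> (L : set V) <> [set 0] ->
    (K : set V) `&` L <> [set 0].

End Submodules.
Arguments submod0 {R} V.
Arguments uniform {R} V.

Section Image.
Variables (R : pzRingType) (V W : lmodType R).

Lemma submod_image_subproof (f : {linear V -> W}) (K : submod V) :
  submod_closed (mem (f @` (K : set V))).
Proof.
split=> [|a u v].
  by rewrite inE; exists 0; rewrite ?linear0//; apply/set_mem/(submod_setP K).1.
rewrite !inE => -[x Kx <-] [y Ky <-]; exists (a *: x + y); rewrite ?linearP//.
by apply/set_mem/(submod_setP K).2; exact/mem_set.
Qed.
Definition submod_image (f : {linear V -> W}) (K : submod V) : submod W :=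
  Submod (submod_image_subproof f K).

End Image.

(* The direct sum of copies of [M] indexed by [I]: the finitely supported
   functions [I -> M]. *)
Section DirectSum.
Variables (R : pzRingType) (I : Type) (M : lmodType R).

Definition finsupp_set : set (I -> M) :=
  [set f | finite_set [set i | f i <> 0]].

Lemma copies_subproof : submod_closed (mem finsupp_set).
Proof.
split=> [|a u v].
  by rewrite inE /finsupp_set /=; apply: (sub_finite_set _ (@finite_set0 I)).
rewrite !inE /finsupp_set /= => fu fv.
apply: (sub_finite_set (B := [set i | u i <> 0] `|` [set i | v i <> 0])).
  move=> i /= uv0; have [u0|/eqP u0] := eqVneq (u i) 0; last by left.
  right=> v0; apply: uv0.
  by rewrite addrfctE scalrfctE u0 v0 scaler0 addr0.
by rewrite finite_setU.
Qed.
Definition copies : submod (I -> M) := Submod copies_subproof.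

End DirectSum.

Section Sigma.
Variables (R : pzRingType) (M : lmodType R).
Implicit Types X Y Q A B C : lmodType R.

Definition generated X : Prop :=
  exists (I : Type) (g : {linear copies I M -> X}), range g = [set: X].

Definition in_sigma X : Prop :=
  exists (Y : lmodType R) (S : submod Y) (f : {linear X -> S}),
    generated Y /\ bijective f.

Definition short_exact A B C (f : {linear A -> B}) (g : {linear B -> C}) :=
  [/\ injective f, range f = g @^-1` [set 0] & range g = [set: C]].

(* Exactness of 0 -> Hom(M,A) -> Hom(M,B) -> Hom(M,C) -> 0. *)
Definition hom_exact A B C (f : {linear A -> B}) (g : {linear B -> C}) :=
  [/\ forall h h' : {linear M -> A}, f \o h =1 f \o h' -> h =1 h',
      forall k : {linear M -> B},
        g \o k =1 \0 <-> exists h : {linear M -> A}, k =1 f \o h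
    & forall l : {linear M -> C}, exists k : {linear M -> B}, l =1 g \o k].

Definition projective_in_sigma : Prop :=
  forall A B C (f : {linear A -> B}) (g : {linear B -> C}),
    in_sigma A -> in_sigma B -> in_sigma C ->
    short_exact f g -> hom_exact f g.

Definition injective_in_sigma Q : Prop :=
  in_sigma Q /\
  forall X Y (f : {linear X -> Y}) (h : {linear X -> Q}),
    in_sigma X -> in_sigma Y -> injective f ->
    exists h' : {linear Y -> Q}, h =1 h' \o f.

Definition injective_hull X Q (i : {linear X -> Q}) : Prop :=
  [/\ injective_in_sigma Q, injective i & essential (range i)].

(* For an embedding [iota : M -> E] and [N] a submodule of [M], the submodule
   [H] of [E] is an injective hull of [N] in sigma[M], [N] being identified
   with its image under [iota]. *)
Definition injective_hull_inside (E : lmodType R) (iota : {linear M -> E})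
    (N : submod M) (H : submod E) : Prop :=
  exists j : {linear N -> H},
    (forall x : N, \val (j x) = iota (\val x)) /\ injective_hull j.

End Sigma.

Section Primes.
Variables (R : pzRingType) (M : lmodType R).
Implicit Types (N K L P Q : submod M).

Definition fully_invariant N : Prop :=
  forall f : {linear M -> M}, f @` (N : set M) `<=` N.

Definition submod_prod K L : submod M :=
  submod_sum
    [set submod_image (\val \o f) K | f in [set: {linear M -> L}]].

Definition prime_in N : Prop :=
  [/\ fully_invariant N, (N : set M) <> [set: M]
    & forall K L, fully_invariant K -> fully_invariant L ->
        submod_prod K L `<=` N -> K `<=` N \/ L `<=` N].

Definition semiprime_in N : Prop :=
  [/\ fully_invariant N, (N : set M) <> [set: M]
    & forall K, fully_invariant K -> submod_prod K K `<=` N -> K `<=` N].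

Definition minimal_prime P : Prop :=
  prime_in P /\ forall Q, prime_in Q -> Q `<=` P -> Q = P.

Definition right_ann N : submod M :=
  submod_sum [set L | submod_prod N L = submod0 M].

Definition annihilator (A : set M) : Prop :=
  exists X : set {linear M -> M}, A = \bigcap_(f in X) (f @^-1` [set 0]).

End Primes.

Definition semiprime_module (R : pzRingType) (M : lmodType R) : Prop :=
  semiprime_in (submod0 M).

Definition acc_annihilators (R : pzRingType) (M : lmodType R) : Prop :=
  forall A : nat -> set M,
    (forall k, annihilator (A k)) -> (forall k, A k `<=` A k.+1) ->
    exists n, forall m, (n <= m)%N -> A m = A n.

(* Main.v *)
Require Import Defs.
From HB Require Import structures.
From mathcomp Require Import all_boot all_algebra finmap.
From mathcomp Require Import boolp classical_sets functions cardinality fsbigop.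

Set Implicit Arguments.
Unset Strict Implicit.
Unset Printing Implicit Defensive.

Import GRing.Theory.
Local Open Scope classical_set_scope.
Local Open Scope ring_scope.

(** Write [K L] for [submod_prod K L] and [N_i] for [right_ann (P i)].

    Projectivity of [M] lets an endomorphism with values in a sum of images be
    lifted to the direct sum of the sources ([projective_sum]). Consequently
    [K (L N)] is contained in [(K L) N] ([submod_prodA]), and [K] kills
    [right_ann K] ([right_annP]). With these two facts [M] behaves like a
    semiprime ring: no nonzero submodule squares to zero, even if it is not
    fully invariant ([square_zero]), so [K L = 0] forces [K] and [L] to be
    disjoint ([killed_disjoint]).

    The [N_i] are independent. For [j <> i] the product of [P_j] and [N_j] is
    zero, hence inside the prime [P_i], which does not contain [P_j]; so [N_j]
    lies in [P_i]. A relation between elements of the [N_i] therefore puts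
    each of its terms in both [P_i] and [N_i], whose product is zero.

    The sum of the [N_i] is essential. Every nonzero submodule contains a
    uniform [U], and the annihilator of [U] is a minimal prime
    ([uniform_left_ann_minimal]), so it is some [P_i], and [U] lies in [N_i].

    The rest concerns hulls. Independence goes up along essential extensions
    ([independent_essential]), so the [H i] are independent. A finite direct
    sum of injectives is a retract of [E] ([direct_sum_retract]), and an
    essential retract is everything ([essential_direct_sum_full]). *)

(** * Submodules *)

Section SubmoduleTheory.
Variables (R : pzRingType) (V : lmodType R).
Implicit Types (N K L Z : submod V) (F : set (submod V)).

Lemma submod_in0 N : (N : set V) 0.
Proof. exact/set_mem/(submod_setP N).1. Qed.

Lemma submod_lin N a u v :
  (N : set V) u -> (N : set V) v -> (N : set V) (a *: u + v).
Proof. by move=> /mem_set Nu /mem_set Nv; apply/set_mem/(submod_setP N).2. Qed.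

Lemma submod_scale N a u : (N : set V) u -> (N : set V) (a *: u).
Proof. by move=> Nu; rewrite -[_ *: _]addr0; apply/submod_lin/submod_in0. Qed.

Lemma submod_add N u v :
  (N : set V) u -> (N : set V) v -> (N : set V) (u + v).
Proof. by rewrite -[u in u + v]scale1r; apply: submod_lin. Qed.

Lemma submod_opp N u : (N : set V) u -> (N : set V) (- u).
Proof. by rewrite -scaleN1r; apply: submod_scale. Qed.

Lemma submod_bigsum N (I : eqType) (s : seq I) (P : pred I) (f : I -> V) :
  (forall i, i \in s -> P i -> (N : set V) (f i)) ->
  (N : set V) (\sum_(i <- s | P i) f i).
Proof.
move=> Nf; rewrite big_seq_cond; elim/big_ind: _ => [||i /andP[]].
- exact: submod_in0.
- exact: submod_add.
- exact: Nf.
Qed.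

Lemma submod_eq N K : (N : set V) = K -> N = K.
Proof.
case: N K => [N NP] [K KP] /= NK; case: _ / NK KP => KP.
by congr Submod; apply: Prop_irrelevance.
Qed.

Lemma submod_nontrivial N :
  (N : set V) <> [set 0] -> exists2 x, (N : set V) x & x <> 0.
Proof.
move=> N0; apply: contra_notP N0 => /forall2NP xN.
rewrite eqEsubset; split=> [x Nx|_ ->]; last exact: submod_in0.
by case: (xN x) => // /contrapT.
Qed.

Lemma full_subproof : submod_closed (mem [set: V]).
Proof. by split=> [|a u v _ _]; apply: mem_set. Qed.
Definition full : submod V := Submod full_subproof.

Lemma cyclic_subproof (x : V) : submod_closed (mem [set a *: x | a in [set: R]]).
Proof.
split=> [|a u v]; first by rewrite inE; exists 0; rewrite ?scale0r.
rewrite !inE => -[b _ <-] [c _ <-]; exists (a * b + c) => //.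
by rewrite scalerDl scalerA.
Qed.
Definition cyclic (x : V) : submod V := Submod (cyclic_subproof x).

Lemma cyclic_self x : (cyclic x : set V) x.
Proof. by exists 1; rewrite ?scale1r. Qed.

Lemma cyclic_sub N x : (N : set V) x -> cyclic x `<=` N.
Proof. by move=> Nx _ [a _ <-]; apply: submod_scale. Qed.

Lemma cyclic_neq0 x : x <> 0 -> (cyclic x : set V) <> [set 0].
Proof. by move=> x0 E; apply: x0; have := cyclic_self x; rewrite E. Qed.

Lemma submod_sum_ind F (Q : V -> Prop) : Q 0 ->
  (forall N x y, F N -> (N : set V) x -> Q y -> Q (x + y)) ->
  forall x, (submod_sum F : set V) x -> Q x.
Proof.
move=> Q0 QD _ [s sF ->]; elim: s sF => [|y s IH] sF; first by rewrite big_nil.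
rewrite big_cons; have [N FN Ny] := sF y (mem_head _ _).
by apply: (QD N) => //; apply: IH => z zs; apply: sF; rewrite inE zs orbT.
Qed.

Lemma submod_sum_min F Z :
  (forall N, F N -> N `<=` Z) -> submod_sum F `<=` Z.
Proof.
move=> FZ; apply: submod_sum_ind => [|N x y /FZ NZ /NZ]; first exact: submod_in0.
exact: submod_add.
Qed.

Lemma submod_sum_sup F N : F N -> N `<=` submod_sum F.
Proof.
move=> FN x Nx; exists [:: x]; last by rewrite big_seq1.
by move=> y; rewrite inE => /eqP ->; exists N.
Qed.


Lemma essential_multiple (A : set V) x : A 0 -> essential A -> x <> 0 ->
  exists2 a, A (a *: x) & a *: x <> 0.
Proof.
move=> A0 essA /cyclic_neq0/essA; apply: contra_notP => /forall2NP Ax.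
rewrite eqEsubset; split=> [_ [[a _ <-] Aax]|_ ->].
  by case: (Ax a) => // /contrapT.
by split=> //; apply: submod_in0.
Qed.

(** Relations between elements instead of intersections with partial sums:
    such relations can be multiplied by scalars and pulled back along
    injective maps. *)
Definition independent (I : finType) (A : I -> submod V) : Prop :=
  forall x : I -> V, (forall i, (A i : set V) (x i)) -> \sum_i x i = 0 ->
  forall i, x i = 0.

Lemma submod_sum_familyP (I : finType) (A : I -> submod V) (D : set I) x :
  (submod_sum [set A i | i in D] : set V) x ->
  exists y : I -> V, [/\ forall i, (A i : set V) (y i),
    forall i, ~ D i -> y i = 0 & x = \sum_i y i].
Proof.
move: x; apply: submod_sum_ind => [|N x y [i Di <-] Aix [z [Az z0 ->]]].
  exists (fun=> 0); split=> [i|//|]; first exact: submod_in0.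
  by rewrite big1.
exists (fun j => (if j == i then x else 0) + z j); split=> [j|j nDj|].
- apply: submod_add => //; case: eqP => [->//|_]; exact: submod_in0.
- by rewrite z0// addr0; case: eqP nDj => [->|].
- by rewrite big_split /= -big_mkcond big_pred1_eq.
Qed.

Lemma independent_direct_sum n (A : 'I_n -> submod V) :
  independent A -> (forall x, (submod_sum [set A i | i in setT] : set V) x) ->
  internal_direct_sum A.
Proof.
move=> indA sumA; split=> [|i]; first by rewrite eqEsubset; split.
rewrite eqEsubset; split=> [x [Aix]|_ ->]; last by split; apply: submod_in0.
case/submod_sum_familyP=> y [Ay yi xE].
have xij j : (A j : set V) (if j == i then x else 0).
  by case: eqP => [->//|_]; apply: submod_in0.
suff: y i - (if i == i then x else 0) = 0.
  have yi0 : y i = 0 by apply: yi; rewrite /= eqxx.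
  by rewrite eqxx yi0 sub0r => /eqP; rewrite oppr_eq0 => /eqP.
apply: (indA (fun j => y j - (if j == i then x else 0))) => [j|].
  by apply: submod_add => //; apply: submod_opp.
by rewrite big_split /= sumrN -big_mkcond big_pred1_eq -xE subrr.
Qed.

(** Independence passes to essential extensions: treating the indices one
    after the other, a nonzero vector with entries in the [B i] is scaled to a
    nonzero vector with entries in the [A i]. *)
Lemma independent_essential (I : finType) (A B : I -> submod V) :
  (forall i x, (B i : set V) x -> x <> 0 ->
     exists2 a, (A i : set V) (a *: x) & a *: x <> 0) ->
  independent A -> independent B.
Proof.
move=> essA indA x Bx sumx i; apply: contrapT => xi0.
have [a Aax [j axj0]] : exists2 a, forall j, j \in enum I ->
    (A j : set V) (a *: x j) & exists j, a *: x j <> 0.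
  elim: (enum I) => [|k s [a Aax [j axj0]]].
    by exists 1 => //; exists i; rewrite scale1r.
  have [axk0|/eqP axk0] := eqVneq (a *: x k) 0.
    exists a; last by exists j.
    by move=> l; rewrite inE => /orP[/eqP ->|/Aax//]; rewrite axk0; apply: submod_in0.
  have [|b Abaxk baxk0] := essA k (a *: x k) _ axk0; first exact: submod_scale.
  exists (b * a); last by exists k; rewrite -scalerA.
  move=> l; rewrite -scalerA inE => /orP[/eqP ->//|/Aax]; exact: submod_scale.
apply: axj0; apply: (indA (fun j => a *: x j)).
- by move=> k; apply: Aax; rewrite mem_enum.
- by rewrite -scaler_sumr sumx scaler0.
Qed.

End SubmoduleTheory.
Arguments full {R} V.

(** * Linear maps and membership in the category sigma[M] *)

Section LinearMaps.
Variables (R : pzRingType) (V W : lmodType R).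

(** Linear maps obtained by choice or from a submodule come as bare functions
    with a separate proof of linearity; this bundles the two. *)
Definition linear_of (f : V -> W) of linear f : V -> W := f.
HB.instance Definition _ f fL :=
  GRing.isLinear.Build R V W *:%R (@linear_of f fL) fL.

Variables (f : {linear V -> W}) (N : submod W).
Hypothesis fN : forall x, (N : set W) (f x).

Definition corestrict (x : V) : N := SubmodElt (mem_set (fN x)).

Lemma corestrict_linear : linear corestrict.
Proof. by move=> a x y; apply: val_inj; rewrite /= linearP. Qed.
HB.instance Definition _ :=
  GRing.isLinear.Build R V N *:%R corestrict corestrict_linear.

End LinearMaps.

Section Kernel.
Variables (R : pzRingType) (V W : lmodType R) (f : {linear V -> W}).

Lemma kernel_subproof : submod_closed (mem (f @^-1` [set 0])).
Proof.
split=> [|a u v]; first by rewrite inE /= linear0.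
by rewrite !inE /= linearP => -> ->; rewrite scaler0 addr0.
Qed.
Definition kernel : submod V := Submod kernel_subproof.

End Kernel.

Section InSigma.
Variables (R : pzRingType) (M : lmodType R).

Lemma in_sigma_inj (X Y : lmodType R) (f : {linear X -> Y}) :
  injective f -> in_sigma M Y -> in_sigma M X.
Proof.
move=> f_inj [Z [S [phi [genZ /bij_inj phi_inj]]]].
pose g : {linear X -> Z} := \val \o (phi \o f).
have gS x : (submod_image g (full X) : set Z) (g x) by exists x.
exists Z, (submod_image g (full X)), (corestrict gS); split=> //.
rewrite -setTT_bijective; split=> [//|x y _ _ gxy|].
  exact/f_inj/phi_inj/val_inj/(congr1 val gxy).
by move=> [y yS] _; have [x _ gxy] := set_mem yS; exists x => //; apply: val_inj.
Qed.

Lemma generated_in_sigma (X : lmodType R) : generated M X -> in_sigma M X.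
Proof.
move=> genX; exists X, (full X), (@corestrict _ _ _ idfun (full X) (fun=> I)).
split=> //; rewrite -setTT_bijective; split=> [//|x y _ _ /(congr1 val)//|].
by move=> [y yT] _; exists y => //; apply: val_inj.
Qed.

Lemma copies_in_sigma (I : Type) : in_sigma M (copies I M).
Proof.
apply: generated_in_sigma; exists I, idfun.
by rewrite eqEsubset; split=> // x _; exists x.
Qed.

Lemma self_in_sigma : in_sigma M M.
Proof.
apply: generated_in_sigma.
have ev_linear : linear (fun h : copies unit M => \val h tt) by [].
exists unit, (linear_of ev_linear); rewrite eqEsubset; split=> // x _.
have xfin : (copies unit M : set (unit -> M)) (fun=> x).
  by rewrite /finsupp_set /=; apply: finite_finset.
by exists (SubmodElt (mem_set xfin)).
Qed.

Lemma submod_in_sigma (X : lmodType R) (N : submod X) :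
  in_sigma M X -> in_sigma M N.
Proof. exact: (in_sigma_inj (f := \val) val_inj). Qed.

End InSigma.

(** * Lifting along sums of images *)

Section Lifting.
Variables (R : pzRingType) (M : lmodType R) (I : choiceType).
Variables (g : I -> {linear M -> M}) (L : I -> submod M).

Lemma coproduct_subproof :
  submod_closed (mem [set h : copies I M | forall i, (L i : set M) (\val h i)]).
Proof.
split=> [|a u v]; first by rewrite inE => i; apply: submod_in0.
by rewrite !inE => uL vL i; apply: submod_lin.
Qed.
Definition coproduct : submod (copies I M) := Submod coproduct_subproof.

Definition sum_map (h : coproduct) : M :=
  \sum_(i \in [set: I]) g i (\val (\val h) i).

Lemma coordinate_linear i : linear (fun h : coproduct => \val (\val h) i).
Proof.
have coordL : linear (fun h : copies I M => \val h i) by [].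
by move=> a u v; rewrite linearP; apply: coordL.
Qed.

Lemma finite_support (h : copies I M) :
  exists A : {fset I}, forall i, i \notin A -> \val h i = 0.
Proof.
have /finite_fsetP[A hA] : finite_set [set i | \val h i <> 0].
  exact/set_mem/(valP h).
exists A => i iA; apply: contrapT => hi; case/negP: iA.
by have : [set` A] i by rewrite -hA.
Qed.

Lemma sum_mapE (h : coproduct) (A : {fset I}) :
  (forall i, i \notin A -> \val (\val h) i = 0) ->
  sum_map h = \sum_(i <- A) g i (\val (\val h) i).
Proof. by move=> hA; apply: fsbigTE => i /hA ->; rewrite linear0. Qed.

Lemma sum_map_linear : linear sum_map.
Proof.
move=> a u v.
have [A uA] := finite_support (\val u); have [B vB] := finite_support (\val v).
have {}uA i : i \notin (A `|` B)%fset -> \val (\val u) i = 0.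
  by rewrite inE negb_or => /andP[/uA].
have {}vB i : i \notin (A `|` B)%fset -> \val (\val v) i = 0.
  by rewrite inE negb_or => /andP[_ /vB].
rewrite (sum_mapE uA) (sum_mapE vB) (@sum_mapE _ (A `|` B)%fset) => [|i iAB].
  rewrite scaler_sumr -big_split; apply: eq_bigr => i _.
  by rewrite coordinate_linear; apply: linearP.
by rewrite coordinate_linear uA// vB// scaler0 addr0.
Qed.
HB.instance Definition _ :=
  GRing.isLinear.Build R coproduct M *:%R sum_map sum_map_linear.

(** The only use of projectivity: an endomorphism with values in
    [\sum_i g i (L i)] lifts along the epimorphism [sum_map] from the direct sum
    of the [L i], so on each element it is a finite sum of values of maps
    [g i \o h] with [h] into [L i]. Hence it maps [K] into [Z] as soon as all
    those maps do. *)
Lemma projective_sum (K Z : submod M) (f : {linear M -> M}) :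
  projective_in_sigma M ->
  (forall x, (submod_sum [set submod_image (g i) (L i) | i in setT] : set M) (f x)) ->
  (forall i (h : {linear M -> M}), (forall x, (L i : set M) (h x)) ->
     forall x, (K : set M) x -> (Z : set M) (g i (h x))) ->
  forall x, (K : set M) x -> (Z : set M) (f x).
Proof.
move=> projM f_sum gZ x Kx; pose C := submod_image sum_map (full coproduct).
have CP y : (C : set M) (sum_map y) by exists y.
have fC y : (C : set M) (f y).
  apply: submod_sum_min (f_sum y) => _ [i _ <-] _ [z Lz <-].
  (* the element supported at [i] with value [z] *)
  pose h j : M := if j == i then z else 0.
  have h_fin : (copies I M : set (I -> M)) h.
    by apply: (sub_finite_set _ (finite_set1 i)) => j; rewrite /= /h; case: eqP.
  have h_cop : (coproduct : set (copies I M)) (SubmodElt (mem_set h_fin)).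
    by move=> j; rewrite /= /h; case: eqP => [->//|_]; apply: submod_in0.
  exists (SubmodElt (mem_set h_cop)) => //.
  apply: etrans (@sum_mapE _ [fset i]%fset _) _ => [j|].
    by rewrite inE /= /h => /negPf ->.
  by rewrite big_seq_fset1 /= /h eqxx.
have sig_cop : in_sigma M coproduct.
  exact/submod_in_sigma/copies_in_sigma.
have sig_C : in_sigma M C by exact/submod_in_sigma/self_in_sigma.
pose A := kernel (corestrict CP).
have [//|_ _ /(_ (corestrict fC))[k fk]] :=
    projM _ _ _ (\val : {linear A -> coproduct}) (corestrict CP)
      (submod_in_sigma _ sig_cop) sig_cop sig_C.
  split; first exact: val_inj.
    rewrite eqEsubset; split=> [_ [[y yA] _ <-]|y Ay]; first exact: set_mem yA.
    by exists (SubmodElt (mem_set (Ay : (A : set coproduct) y))).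
  rewrite eqEsubset; split=> // -[y yC] _.
  by have [h _ hy] := set_mem yC; exists h => //; apply: val_inj.
have -> : f x = sum_map (k x) by have /(congr1 val) := fk x.
have [S kS] := finite_support (\val (k x)); rewrite (sum_mapE kS).
apply: submod_bigsum => i _ _.
have k_linear : linear (fun y => \val (\val (k y)) i).
  by move=> a u v; rewrite (linearP k); apply: coordinate_linear.
apply: (gZ i (linear_of k_linear)) => // y.
exact: (set_mem (valP (k y))).
Qed.

End Lifting.

(** * Products of submodules *)

Section Products.
Variables (R : pzRingType) (M : lmodType R).
Implicit Types (K L N P Q U Z : submod M).

Lemma submod_prod_min K L Z :
  (forall f : {linear M -> M}, (forall x, (L : set M) (f x)) ->
     forall x, (K : set M) x -> (Z : set M) (f x)) ->
  submod_prod K L `<=` Z.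
Proof.
move=> fZ; apply: submod_sum_min => _ [f _ <-] _ [x Kx <-].
by apply: (fZ (\val \o f)) => // y; apply/set_mem/(valP (f y)).
Qed.

Lemma submod_prod_in K L (f : {linear M -> M}) x :
  (forall y, (L : set M) (f y)) -> (K : set M) x ->
  (submod_prod K L : set M) (f x).
Proof.
move=> fL Kx.
apply: (submod_sum_sup (N := submod_image (\val \o corestrict fL) K)).
  by exists (corestrict fL).
by exists x.
Qed.

Lemma submod_prodSr K L N : L `<=` N -> submod_prod K L `<=` submod_prod K N.
Proof.
move=> LN; apply: submod_prod_min => f fL x Kx.
by apply: submod_prod_in => // y; apply: LN.
Qed.

Lemma submod_prodSl K L N : K `<=` L -> submod_prod K N `<=` submod_prod L N.
Proof.
move=> KL; apply: submod_prod_min => f fN x Kx.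
by apply: submod_prod_in => //; apply: KL.
Qed.

Lemma fully_invariant_prod_sub K L : fully_invariant K -> submod_prod K L `<=` K.
Proof. by move=> Kinv; apply: submod_prod_min => f _ x Kx; apply: Kinv; exists x. Qed.

Lemma submod_prod_sub K L : submod_prod K L `<=` L.
Proof. by apply: submod_prod_min. Qed.

(** The least fully invariant submodule containing [K]. It carries statements
    about fully invariant submodules, such as primeness, over to all [K]. *)
Definition saturation K : submod M := submod_prod K (full M).

Lemma saturation_sup K : K `<=` saturation K.
Proof. by move=> x Kx; apply: (submod_prod_in (f := idfun)). Qed.

Lemma saturation_invariant K : fully_invariant (saturation K).
Proof.
move=> f _ [x Kx <-]; move: x Kx; apply: submod_sum_ind.
  by rewrite linear0; apply: submod_in0.
move=> _ x y [h _ <-] [z Kz <-] fy; rewrite linearD; apply: submod_add => //.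
exact: (submod_prod_in (f := f \o (\val \o h))).
Qed.

(** By [left_annP] below this is the largest [K] with [K L = 0]. Describing it
    as an intersection of kernels, instead of a sum of such [K], makes that
    property immediate. *)
Definition left_ann_set L : set M :=
  [set x | forall f : {linear M -> M}, (forall y, (L : set M) (f y)) -> f x = 0].

Lemma left_ann_subproof L : submod_closed (mem (left_ann_set L)).
Proof.
split=> [|a u v]; first by rewrite inE => f _; apply: linear0.
rewrite !inE => uL vL f fL; rewrite linearP uL// vL//.
by rewrite scaler0 addr0.
Qed.
Definition left_ann L : submod M := Submod (left_ann_subproof L).

Lemma left_annP K L : submod_prod K L `<=` [set 0] <-> K `<=` left_ann L.
Proof.
split=> [KL0 x Kx f fL|KL]; first exact/KL0/submod_prod_in.
by apply: (@submod_prod_min _ _ (submod0 M)) => f fL x /KL; apply.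
Qed.

Lemma left_ann_invariant L : fully_invariant (left_ann L).
Proof. by move=> f _ [x Lx <-] h hL; apply: (Lx (h \o f)) => y; apply: hL. Qed.

Lemma fully_invariant_saturation K N :
  fully_invariant N -> K `<=` N -> saturation K `<=` N.
Proof.
move=> Ninv KN; apply: submod_prod_min => f _ x /KN Nx.
by apply: Ninv; exists x.
Qed.

Section Projective.
Hypothesis projM : projective_in_sigma M.

(** An endomorphism into [L N] takes values in the sum of the [g L], for [g]
    into [N], so it lifts to finite sums of maps [g \o h] with [h] into [L];
    and [g \o h] maps [K] into [(K L) N]. *)
Lemma submod_prodA K L N :
  submod_prod K (submod_prod L N) `<=` submod_prod (submod_prod K L) N.
Proof.
apply: submod_prod_min => f fLN.
pose I := {classic {g : {linear M -> M} | forall x, (N : set M) (g x)}}.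
apply: (@projective_sum _ _ I
  (fun g => sval (g : {g : {linear M -> M} | _})) (fun=> L)) => // [x|].
  have := fLN x; move: (f x); apply: submod_prod_min => g gN y Ly.
  apply: (submod_sum_sup (N := submod_image g L)); last by exists y.
  by exists (exist _ g gN : I).
move=> [g gN] h hL x Kx /=; apply: submod_prod_in => //.
exact: submod_prod_in.
Qed.

(** Products distribute over sums in the right factor, so [right_ann K] is
    itself killed by [K]. *)
Lemma right_annP K L :
  submod_prod K L `<=` [set 0] <-> L `<=` right_ann K.
Proof.
split=> [KL0|LK]; first apply: submod_sum_sup.
  apply: submod_eq; rewrite eqEsubset; split=> // _ ->; exact: submod_in0.
apply: (@submod_prod_min _ _ (submod0 M)) => f fL.
pose S := {N : submod M | submod_prod K N = submod0 M}.
pose I : choiceType := {classic S}; pose factor (N : I) : submod M := sval (N : S).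
apply: (@projective_sum _ _ I (fun=> idfun : {linear M -> M}) factor
  K (submod0 M)) => // [x|].
  apply: submod_sum_min (LK _ (fL x)) => N KN y Ny.
  apply: (submod_sum_sup (N := submod_image idfun N)); last by exists y.
  by exists (exist _ N KN : I).
by move=> [N KN] h hN x Kx; rewrite -KN /=; apply: submod_prod_in.
Qed.

Section Semiprime.
Hypothesis semiM : semiprime_module M.

(** If [K K = 0], the fully invariant [left_ann K] contains [K], hence also the
    saturation [S] of [K]: thus [S K = 0], so [S S = S (K M) = (S K) M = 0], and
    semiprimeness applies to [S]. *)
Lemma square_zero K : submod_prod K K `<=` [set 0] -> K `<=` [set 0].
Proof.
move=> /left_annP/(fully_invariant_saturation (@left_ann_invariant K))/left_annP KK0.
have [inv0 _ semi] := semiM.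
apply: (subset_trans (@saturation_sup K)).
apply: semi (@saturation_invariant K) _ => x /submod_prodA.
by move=> /(submod_prodSl (L := submod0 M) KK0)/(fully_invariant_prod_sub inv0).
Qed.

Lemma killed_disjoint K L x :
  submod_prod K L `<=` [set 0] -> (K : set M) x -> (L : set M) x -> x = 0.
Proof.
move=> KL0 /cyclic_sub xK /cyclic_sub xL.
apply: (@square_zero (cyclic x)); last exact: cyclic_self.
by move=> y /(submod_prodSl xK)/(submod_prodSr xL)/KL0.
Qed.

Lemma uniform_common_multiple U x y : uniform U ->
  (U : set M) x -> (U : set M) y -> x <> 0 -> y <> 0 ->
  exists z, [/\ (cyclic x : set M) z, (cyclic y : set M) z & z <> 0].
Proof.
move=> [_ unifU] Ux Uy x0 y0.
pose x' : U := SubmodElt (mem_set Ux); pose y' : U := SubmodElt (mem_set Uy).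
have [x'0 y'0] : x' <> 0 /\ y' <> 0 by split=> /(congr1 val).
have := unifU _ _ (cyclic_neq0 x'0) (cyclic_neq0 y'0).
apply: contra_notP => /forallNP nz; rewrite eqEsubset; split.
  move=> z [[a _ za] [b _ zb]]; apply: contrapT => z0; apply: (nz (\val z)).
  split; first by exists a => //; rewrite -za.
    by exists b => //; rewrite -zb.
  by move=> vz0; apply: z0; apply: val_inj.
by move=> _ ->; split; apply: submod_in0.
Qed.

(** If fully invariant [A] and [B] have product inside the annihilator of a
    uniform [U] but neither annihilates [U], then the nonzero submodules [A U]
    and [B U] of [U] meet in some [z <> 0]; but [z] lies in [A] and in [B U],
    while [A (B U) = (A B) U = 0]. *)
Lemma uniform_left_ann_prime U : uniform U -> prime_in (left_ann U).
Proof.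
move=> unifU; split; first exact: left_ann_invariant.
  move=> annT; case: unifU => + _; apply.
  have U0 : U `<=` [set 0].
    apply: square_zero; apply/left_annP; rewrite annT; exact: subsetT.
  rewrite eqEsubset; split=> // x _.
  by apply: val_inj; apply: U0; apply/set_mem/(valP x).
move=> A B Ainv Binv ABU; apply: contrapT => /not_orP[].
move=> /left_annP/nonsubset[x [AUx x0]] /left_annP/nonsubset[y [BUy y0]].
have [z [xz yz z0]] := uniform_common_multiple unifU
  (submod_prod_sub AUx) (submod_prod_sub BUy) x0 y0.
apply: z0; apply: (@killed_disjoint A (submod_prod B U)).
- by move=> w /submod_prodA; apply/left_annP: w.
- exact/(fully_invariant_prod_sub Ainv)/(cyclic_sub AUx).
- exact: cyclic_sub BUy _ yz.
Qed.

(** A prime [Q] contained in [left_ann U] contains the product [0] of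
    [left_ann U] with the saturation of [U]; it cannot contain [U], which would
    then square to zero, so it contains [left_ann U]. *)
Lemma uniform_left_ann_minimal U : uniform U -> minimal_prime (left_ann U).
Proof.
move=> unifU; split; first exact: uniform_left_ann_prime.
move=> Q [Qinv QT Qprime] QU; apply: submod_eq; rewrite eqEsubset; split=> //.
have annU0 : submod_prod (left_ann U) U `<=` [set 0] by apply/left_annP.
have [inv0 _ _] := semiM.
have [|//|satQ] :=
    Qprime _ _ (@left_ann_invariant U) (@saturation_invariant U).
  move=> x /submod_prodA/(submod_prodSl (L := submod0 M) annU0).
  by move=> /(fully_invariant_prod_sub inv0) ->; apply: submod_in0.
case: unifU => + _; case; rewrite eqEsubset; split=> // x _.
apply: val_inj; have Ux := set_mem (valP x).
apply: (killed_disjoint annU0 _ Ux).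
exact/QU/satQ/saturation_sup.
Qed.

(** [P] kills [right_ann P], so the prime [Q] contains one of them; by
    minimality [Q] cannot contain the other minimal prime [P]. *)
Lemma right_ann_sub_prime P Q : minimal_prime P -> minimal_prime Q ->
  P <> Q -> right_ann P `<=` Q.
Proof.
move=> [Pprime _] [Qprime Qmin] PQ.
have [inv0 _ _] := semiM; have [Pinv _ _] := Pprime.
have PN0 : submod_prod P (right_ann P) `<=` [set 0] by apply/right_annP.
have [_ _ Qp] := Qprime.
have [x /submod_prodA/(submod_prodSl (L := submod0 M) PN0)|PsubQ|] :=
    Qp _ _ Pinv (@saturation_invariant (right_ann P)).
- by move=> /(fully_invariant_prod_sub inv0) ->; apply: submod_in0.
- by case: PQ; apply: Qmin.
- exact: subset_trans (@saturation_sup _).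
Qed.

Lemma right_ann_independent n (P : 'I_n -> submod M) :
  injective P -> (forall i, minimal_prime (P i)) ->
  independent (fun i => right_ann (P i)).
Proof.
move=> Pinj Pmin x Nx sumx i.
apply: (@killed_disjoint (P i) (right_ann (P i))) => //; first exact/right_annP.
have -> : x i = - \sum_(j | j != i) x j.
  by apply/eqP; rewrite -addr_eq0; move: sumx; rewrite (bigD1 i) //= => ->.
apply/submod_opp/submod_bigsum => j _ ji; apply: (right_ann_sub_prime (P := P j)) => //.
by move=> /Pinj/eqP; apply/negP.
Qed.

Lemma uniform_sub_right_ann U : U `<=` right_ann (left_ann U).
Proof. exact/right_annP/left_annP. Qed.

End Semiprime.
End Projective.
End Products.

(** * Sums of injective submodules *)

Section InjectiveSums.
Variables (R : pzRingType) (M E : lmodType R) (I : finType).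
Variable H : I -> submod E.
Hypotheses (indH : independent H) (injH : forall i, injective_in_sigma M (H i)).
Hypothesis sigE : in_sigma M E.

Let T := submod_sum [set H i | i in [set: I]].

(** The projections of the direct sum [T] onto its summands extend to [E] by
    injectivity, and the sum of the extensions is a retraction of [E] onto [T]. *)
Lemma direct_sum_retract : exists q : {linear E -> E},
  (forall x, (T : set E) (q x)) /\ (forall x, (T : set E) x -> q x = x).
Proof.
have dec (x : T) : exists y : I -> E,
    (forall i, (H i : set E) (y i)) /\ \val x = \sum_i y i.
  by have [y [Hy _ xE]] := submod_sum_familyP (set_mem (valP x)); exists y.
pose p x := sval (cid (dec x)).
have pH x i : (H i : set E) (p x i) by rewrite /p; case: cid => ? [].
have pE x : \val x = \sum_i p x i by rewrite /p; case: cid => ? [].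
have p_linear i : linear (fun x => p x i).
  move=> a x y; apply/eqP; rewrite -subr_eq0; apply/eqP.
  (* the projections are defined by choice: uniqueness makes them linear *)
  apply: (indH (x := fun i => p (a *: x + y) i - (a *: p x i + p y i))) => [j|].
    by apply: submod_add => //; apply/submod_opp/submod_lin.
  rewrite sumrB -pE big_split -scaler_sumr -!pE.
  by apply/eqP; rewrite subr_eq0; apply/eqP; apply: linearP.
have ext i : exists q : {linear E -> E},
    (forall x, (H i : set E) (q x)) /\ (forall x : T, q (\val x) = p x i).
  pose pi := corestrict (f := linear_of (p_linear i)) (fun x => pH x i).
  have [_ inj] := injH i.
  have [q qE] := inj _ _ (\val : {linear T -> E}) pi
    (submod_in_sigma T sigE) sigE val_inj.
  exists (\val \o q); split=> x; first exact/set_mem/(valP (q x)).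
  by have /(congr1 val) := qE x.
have {ext} [q qE] := choice ext.
have Q_linear : linear (fun x => \sum_i q i x).
  move=> a x y; rewrite scaler_sumr -big_split; apply: eq_bigr => i _.
  exact: linearP.
exists (linear_of Q_linear); split=> x.
  apply: submod_bigsum => i _ _.
  by apply: (submod_sum_sup (N := H i)); [exists i|have [qH _] := qE i].
move=> Tx; pose t : T := SubmodElt (mem_set Tx).
by rewrite -[RHS]/(\val t) pE; apply: eq_bigr => i _; have [_ <-] := qE i.
Qed.

(** The kernel of the retraction meets the essential [T] in zero, so it is
    zero; it contains every [q x - x]. *)
Lemma essential_direct_sum_full :
  (forall x : E, x <> 0 -> exists2 a, (T : set E) (a *: x) & a *: x <> 0) ->
  forall x, (T : set E) x.
Proof.
move=> essT x; have [q [qT q_id]] := direct_sum_retract.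
suff <- : q x = x by [].
apply/eqP; rewrite -subr_eq0; apply/eqP; apply: contrapT => /essT[a Taz].
by rewrite -(q_id _ Taz) linearZ linearB /= (q_id _ (qT x)) subrr scaler0.
Qed.

End InjectiveSums.

Theorem theorem2p18 (R : pzRingType) (M : lmodType R)
  (E : lmodType R) (iota : {linear M -> E})
  (n : nat) (P : 'I_n -> submod M) (H : 'I_n -> submod E) :
  projective_in_sigma M ->
  semiprime_module M ->
  acc_annihilators M ->
  (forall N : submod M, (N : set M) <> [set 0] ->
     exists U : submod M, (U : set M) `<=` N /\ uniform U) ->
  injective P ->
  (forall Q : submod M, minimal_prime Q <-> exists i, P i = Q) ->
  injective_hull M iota ->
  (forall i, injective_hull_inside iota (right_ann (P i)) (H i)) ->
  internal_direct_sum H.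
Proof.
move=> projM semiM _ uniM Pinj Pmin [[sigE _] iota_inj essM] hullH.
have NH i x : (right_ann (P i) : set M) x -> (H i : set E) (iota x).
  move=> Nx; have [j [jE _]] := hullH i.
  by rewrite -(jE (SubmodElt (mem_set Nx))); apply/set_mem/(valP (j _)).
have essH i x : (H i : set E) x -> x <> 0 -> exists2 a,
    (submod_image iota (right_ann (P i)) : set E) (a *: x) & a *: x <> 0.
  move=> Hx x0; have [j [jE [_ _ essj]]] := hullH i.
  pose y : H i := SubmodElt (mem_set Hx).
  have j0 : range j 0 by exists 0; rewrite ?linear0.
  have [|a [z _ jz] ay0] := essential_multiple j0 essj (x := y).
    by move=> /(congr1 val).
  exists a; last by move=> ax0; apply: ay0; apply: val_inj.
  exists (\val z); first exact/set_mem/(valP z).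
  by rewrite -jE jz.
have indH : independent H.
  apply: independent_essential essH _ => x /= Nx sumx i.
  have {Nx} /choice[y yx] : forall i, exists y,
      (right_ann (P i) : set M) y /\ iota y = x i.
    by move=> k; have [y Ny <-] := Nx k; exists y.
  have -> : x i = iota (y i) by case: (yx i).
  rewrite (right_ann_independent projM semiM Pinj _ (x := y)) ?linear0//.
  - by move=> k; apply/Pmin; exists k.
  - by move=> k; case: (yx k).
  - apply: iota_inj; rewrite linear_sum linear0; apply: etrans sumx.
    by apply: eq_bigr => k _; case: (yx k).
apply: independent_direct_sum => //; apply: essential_direct_sum_full sigE _ => //.
  by move=> i; have [j [_ []]] := hullH i.
move=> x x0; have i0 : range iota 0 by exists 0; rewrite ?linear0.
have [a [m _ ma] ax0] := essential_multiple i0 essM x0.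
have m0 : m <> 0 by move=> m0; apply: ax0; rewrite -ma m0 linear0.
have [U [Um unifU]] := uniM _ (cyclic_neq0 m0).
have [i Pi] := (Pmin _).1 (uniform_left_ann_minimal projM semiM unifU).
have [u Uu u0] : exists2 u, (U : set M) u & u <> 0.
  apply: submod_nontrivial => U0; case: unifU => + _; apply.
  rewrite eqEsubset; split=> // y _; apply: val_inj.
  by have := set_mem (valP y); rewrite /submod_pred /= U0.
have [b _ bm] := Um _ Uu; exists (b * a); rewrite -scalerA -ma -linearZ bm.
  apply: (submod_sum_sup (N := H i)); first by exists i.
  by apply: NH; rewrite Pi; apply: uniform_sub_right_ann.
by move=> iu0; apply: u0; apply: iota_inj; rewrite linear0.
Qed.
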